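(* Let $I\subseteq\mathbb{R}$ be an interval, let $g:I\to\mathbb{R}$ be such that $-g'$ is completely monotone, and let $f$ be absolutely monotone in the set $\mathrm{Range}\,g$. Then $f\circ g$ is completely monotone (on $I$).
   Context: A function $f:I\to\mathbb{R}$ on an interval $I\subseteq\mathbb{R}$ is called completely monotone if it has derivatives of all orders and $(-1)^n f^{(n)}(x)\ge 0$ for all $n=0,1,2,\ldots$ and all $x\in I$; it is called absolutely monotone if it has derivatives of all orders and $f^{(n)}(x)\ge 0$ for all $n=0,1,2,\ldots$ and all $x\in I$. $\mathrm{Range}\,g$ denotes the image $g(I)$. *)

(* Defs.v *)
From HB Require Import structures.
From mathcomp Require Import all_boot all_order all_algebra.
From mathcomp Require Import all_classical all_reals all_analysis.
Set Implicit Arguments.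
Unset Strict Implicit.
Unset Printing Implicit Defensive.
Import Order.TTheory GRing.Theory Num.Theory.
Import numFieldNormedType.Exports.
Local Open Scope classical_set_scope.
Local Open Scope ring_scope.

(* Functions on a subset A of R are represented by total functions R -> R;
   none of the definitions below depends on their values outside A. *)

(* The increment y is restricted to A, so that the derivative is two-sided at
   interior points of an interval A and one-sided at the endpoints lying in A.
   At an isolated point of A the filter [within A x^'] is improper and every
   value is a derivative. *)
Definition is_derive_on (R : realType) (A : set R) (f f' : R -> R) : Prop :=
  forall x, A x ->
    (f y - f x) / (y - x) @[y --> within A x^'] --> f' x.

(* On a non-degenerate interval A the values of [F n] on A are determined by
   f: they are those of the n-th derivative of f. *)
Definition derivatives_on (R : realType) (A : set R) (f : R -> R)
    (F : nat -> R -> R) : Prop :=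
  (forall x, A x -> F 0%N x = f x) /\
  (forall n, is_derive_on A (F n) (F n.+1)).

(* If A is a single point (e.g. the range of a constant function), where
   derivatives carry no information, the two notions below reduce to f >= 0. *)
Definition completely_monotone (R : realType) (A : set R) (f : R -> R) : Prop :=
  exists F : nat -> R -> R, derivatives_on A f F /\
    forall n x, A x -> 0 <= (-1) ^+ n * F n x.

Definition absolutely_monotone (R : realType) (A : set R) (f : R -> R) : Prop :=
  exists F : nat -> R -> R, derivatives_on A f F /\
    forall n x, A x -> 0 <= F n x.

(* Main.v *)
Require Import Defs.
From mathcomp Require Import all_boot all_order all_algebra.
From mathcomp Require Import all_classical all_reals all_analysis.
From mathcomp Require Import ring.
Import Order.TTheory GRing.Theory Num.Theory.
Import numFieldNormedType.Exports.
Set Implicit Arguments.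
Unset Strict Implicit.
Local Open Scope classical_set_scope.
Local Open Scope ring_scope.

(* Put P n := (-1)^(n+1) g^(n+1), so that P n >= 0 and (P n)' = - P (n+1), while
   (f^(n) o g)' = - (f^(n+1) o g) * P 0.  Hence the functions generated by the
   P n and the f^(n) o g under sums and products are nonnegative, and this
   class is stable under s |-> - s'; it contains f o g. *)

Section DeriveOn.
Context {R : realType}.
Implicit Types (A B : set R) (f g : R -> R).

Lemma near_dnbhs_neq A (x : R) : \forall y \near within A x^', y != x.
Proof. by rewrite !near_withinE; near=> y => ? ? . Unshelve. all: by end_near. Qed.

(** Off [x], [f y] is the difference quotient times [y - x], plus [f x], and the first product tends
    to 0. *)
Lemma is_derive_on_cvg A f f' x : is_derive_on A f f' -> A x ->
  f y @[y --> within A x^'] --> f x.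
Proof.
move=> df Ax.
have cvg_id : y @[y --> within A x^'] --> x.
  apply: (cvg_trans (cvg_within _)); exact: cvg_within.
have h : (f y - f x) / (y - x) * (y - x) + f x @[y --> within A x^'] -->
    f' x * (x - x) + f x.
  apply: cvgD; last exact: cvg_cst.
  by apply: cvgM; [exact: df | apply: cvgB => //; exact: cvg_cst].
rewrite subrr mulr0 add0r in h.
apply: cvg_trans h; apply: near_eq_cvg.
near=> y; rewrite divfK ?subrK// subr_eq0; near: y; exact: near_dnbhs_neq.
Unshelve. all: by end_near. Qed.

Lemma is_derive_on_cst A (c : R) : is_derive_on A (fun=> c) (fun=> 0).
Proof.
move=> x _; rewrite (_ : (fun y => _) = fun=> 0); first exact: cvg_cst.
by apply/funext => y; rewrite subrr mul0r.
Qed.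

Lemma is_derive_onD A f f' g g' : is_derive_on A f f' -> is_derive_on A g g' ->
  is_derive_on A (fun x => f x + g x) (fun x => f' x + g' x).
Proof.
move=> df dg x Ax; apply: cvg_trans (cvgD (df x Ax) (dg x Ax)).
apply: near_eq_cvg; near=> y; rewrite !fctE /=; ring.
Unshelve. all: by end_near. Qed.

Lemma is_derive_onM A f f' g g' : is_derive_on A f f' -> is_derive_on A g g' ->
  is_derive_on A (fun x => f x * g x) (fun x => f' x * g x + f x * g' x).
Proof.
move=> df dg x Ax.
(* The increment splits as [(f y - f x) * g y + f x * (g y - g x)]; the first term uses the
   continuity of [g] at [x]. *)
apply: cvg_trans (cvgD (cvgM (df x Ax) (is_derive_on_cvg dg Ax))
  (cvgM (cvg_cst (f x)) (dg x Ax))).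
apply: near_eq_cvg; near=> y; rewrite !fctE /=; ring.
Unshelve. all: by end_near. Qed.

Lemma is_derive_on_comp A B f f' g g' : (forall x, A x -> B (g x)) ->
  is_derive_on B f f' -> is_derive_on A g g' ->
  is_derive_on A (f \o g) (fun x => f' (g x) * g' x).
Proof.
move=> gAB df dg x Ax.
(* The slope of f at g x is extended by f' (g x), since g may take the value
   g x again arbitrarily close to x. *)
pose slope u := if u == g x then f' (g x) else (f u - f (g x)) / (u - g x).
have slope_cvg : slope (g y) @[y --> within A x^'] --> f' (g x).
  move=> U U0.
  (* Unfolded, differentiability of [f] is a property of full neighbourhoods of [g x] with two side
     conditions, so continuity of [g] pulls it back to [y]. *)
  have Bf : \forall u \near g x, u != g x -> B u ->
      U ((f u - f (g x)) / (u - g x)) by exact: (df _ (gAB _ Ax) _ U0).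
  have gf : \forall y \near within A x^', g y != g x -> B (g y) ->
      U ((f (g y) - f (g x)) / (g y - g x)) by exact: (is_derive_on_cvg dg Ax Bf).
  have AA : \forall y \near within A x^', A y by exact: withinT.
  change (\forall y \near within A x^', U (slope (g y)));
  near=> y; rewrite /slope; case: eqVneq => [_|gyx]; first exact: nbhs_singleton.
  have By : B (g y) by apply: gAB; near: y.
  by move: gyx By; near: y.
apply: cvg_trans (cvgM slope_cvg (dg x Ax)).
apply: near_eq_cvg; near=> y; rewrite !fctE /= /slope.
case: eqVneq => [->|gyx]; first by rewrite !subrr !mul0r mulr0.
by rewrite mulrA divfK// subr_eq0.
Unshelve. all: by end_near. Qed.

Lemma is_derive_on_eq A f f' g g' : {in A, f =1 g} -> {in A, f' =1 g'} ->
  is_derive_on A f f' -> is_derive_on A g g'.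
Proof.
move=> fg fg' df x Ax; rewrite -fg' ?inE//.
apply: cvg_trans (df x Ax); apply: near_eq_cvg.
have AA : \forall y \near within A x^', A y by exact: withinT.
near=> y; rewrite !fg ?inE//; near: y; exact: AA.
Unshelve. all: by end_near. Qed.

End DeriveOn.

(** Closure under negation is left out so that nonnegativity passes from the generators to the whole
    class. *)
Inductive generated (R : realType) (S : set (R -> R)) : set (R -> R) :=
| gen_base s : S s -> generated S s
| gen_add s t : generated S s -> generated S t -> generated S (fun x => s x + t x)
| gen_mul s t : generated S s -> generated S t -> generated S (fun x => s x * t x).

Lemma generated_ge0 (R : realType) (A : set R) (S : set (R -> R)) s :
  (forall t x, S t -> A x -> 0 <= t x) ->
  generated S s -> forall x, A x -> 0 <= s x.
Proof.
move=> S0; elim=> {s} [s Ss x Ax|s t _ IHs _ IHt x Ax|s t _ IHs _ IHt x Ax].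
- exact: S0.
- by rewrite addr_ge0 ?IHs ?IHt.
- by rewrite mulr_ge0 ?IHs ?IHt.
Qed.

(** By linearity and the Leibniz rule it suffices to differentiate generators, whose negated
    derivatives may lie anywhere in the generated class. *)
Lemma generated_derive_on (R : realType) (A : set R) (S : set (R -> R)) s :
  (forall t, S t ->
    exists2 t', generated S t' & is_derive_on A t (fun x => - t' x)) ->
  generated S s ->
  exists2 s', generated S s' & is_derive_on A s (fun x => - s' x).
Proof.
move=> Sd; elim=> {s} [s /Sd//|s t _ [s' Gs' ds] _ [t' Gt' dt]|
  s t Gs [s' Gs' ds] Gt [t' Gt' dt]].
- exists (fun x => s' x + t' x); first exact: gen_add.
  by apply: is_derive_on_eq (is_derive_onD ds dt) => // x _; rewrite opprD.
- exists (fun x => s' x * t x + s x * t' x).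
    by apply: gen_add; apply: gen_mul.
  by apply: is_derive_on_eq (is_derive_onM ds dt) => // x _; ring.
Qed.

(** Iterating [s |-> - s'] inside [C] produces [(-1)^n s^(n)], which is nonnegative like every
    member of [C]. *)
Lemma completely_monotone_stable (R : realType) (A : set R)
    (C : set (R -> R)) (s : R -> R) :
  (forall t x, C t -> A x -> 0 <= t x) ->
  (forall t, C t -> exists2 t', C t' & is_derive_on A t (fun x => - t' x)) ->
  C s -> completely_monotone A s.
Proof.
move=> C0 Cd Cs.
(* [D] chooses a negated derivative for each member of [C]; outside [C] its value is arbitrary. *)
have /choice[D HD] : forall t, exists t', C t ->
    C t' /\ is_derive_on A t (fun x => - t' x).
  move=> t; have [/Cd[t' Ct' dt]|nCt] := pselect (C t); first by exists t'.
  by exists t.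
have CD n : C (iter n D s) by elim: n => //= n /HD[].
exists (fun n x => (-1) ^+ n * iter n D s x); split; last first.
  by move=> n x Ax; rewrite mulrA -expr2 sqrr_sign mul1r C0.
split=> [x _|n]; first by rewrite mul1r.
have [_ ds] := HD _ (CD n).
apply: is_derive_on_eq (is_derive_onM (@is_derive_on_cst _ _ _) ds) => // x _.
by rewrite exprS iterS; ring.
Qed.

Theorem theorem2p8 (R : realType) (I : set R) (f g g' : R -> R) :
  is_interval I ->
  is_derive_on I g g' ->
  completely_monotone I (fun x => - g' x) ->
  absolutely_monotone (g @` I) f ->
  completely_monotone I (f \o g).
Proof.
move=> _ dg [G [[G0 dG] Gge0]] [F [[F0 dF] Fge0]].
pose P n x := (-1) ^+ n * G n x.
pose S := range (fun n => F n \o g) `|` range P.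
(* [f] and [F 0] are only known to agree on the range of [g], so [F 0 \o g] is treated first; at the
   end only the zeroth term of [H] has to be compared with [f \o g]. *)
have [H [[H0 dH] Hge0]] : completely_monotone I (F 0%N \o g).
  apply: (@completely_monotone_stable _ _ (generated S)).
  - move=> t x Gt; apply: generated_ge0 Gt x => {}t x [] [n _ <-] Ix.
      by apply: Fge0; exists x.
    exact: Gge0.
  - move=> t; apply: generated_derive_on => {}t [] [n _ <-].
      exists (fun x => (F n.+1 \o g) x * P 0%N x).
        by apply: gen_mul; apply: gen_base; [left; exists n.+1|right; exists 0%N].
      (* The chain rule yields the factor [g'], which on [I] equals [- G 0], that is [- P 0]. *)
      apply: is_derive_on_eq (is_derive_on_comp _ (dF n) dg) => //.
      by move=> x; rewrite inE => Ix; rewrite /P G0//=; ring.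
    exists (P n.+1); first by apply: gen_base; right; exists n.+1.
    apply: is_derive_on_eq (is_derive_onM (@is_derive_on_cst _ _ _) (dG n)) => // x _.
    by rewrite /P exprS; ring.
  - by apply: gen_base; left; exists 0%N.
exists H; split=> //; split=> // x Ix; rewrite H0//=.
by apply: F0; exists x.
Qed.
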